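(* Let $E\subset\mathfrak p$ be a $K$-invariant convex body and let $F\subset E$ be a face. Then there exists an abelian subalgebra $\mathfrak s\subset\mathfrak p$ such that (a) $F\subset\mathfrak p^{\mathfrak s}$ and $F$ is $K^{\mathfrak s}$-stable; (b) $\mathrm{Dir}(F)\subset\mathfrak s^\perp$, where $\perp$ denotes the orthogonal complement in $\mathfrak p$.
   Context: Setting: $\mathfrak g$ is a real semisimple Lie algebra with Cartan involution $\theta$ and Cartan decomposition $\mathfrak g=\mathfrak k\oplus\mathfrak p$. $G$ is a connected real semisimple Lie group with Lie algebra $\mathfrak g$, and $K\subset G$ is a maximal compact subgroup with Lie algebra $\mathfrak k$. $K$ acts on $\mathfrak p$ by the adjoint representation, and $\langle\cdot,\cdot\rangle$ is the $K$-invariant scalar product on $\mathfrak p$ given by the restriction of the Killing form. Notation: a convex body is a (nonempty) compact convex set; a face of $E$ is a (nonempty) convex subset $F\subset E$ such that $x,y\in E$ and $\mathrm{relint}[x,y]\cap F\neq\emptyset$ imply $[x,y]\subset F$ ($E$ itself is a face). $\mathrm{Dir}(F)$ is the linear subspace with $\mathrm{Aff}(F)=p+\mathrm{Dir}(F)$, $\mathrm{Aff}(F)$ being the affine hull of $F$. For $B\subset\mathfrak p$: $\mathfrak p^B=\{\eta\in\mathfrak p:[\eta,\xi]=0\ \text{for all }\xi\in B\}$ and $K^B=\{k\in K:\mathrm{Ad}(k)\xi=\xi\ \text{for all }\xi\in B\}$. *)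

(* Defs.v *)
From HB Require Import structures.
From mathcomp Require Import all_boot all_order all_algebra.
From mathcomp Require Import all_classical all_reals all_analysis.

Set Implicit Arguments.
Unset Strict Implicit.
Unset Printing Implicit Defensive.

Import Order.TTheory GRing.Theory Num.Theory.
Import numFieldNormedType.Exports.

Local Open Scope classical_set_scope.
Local Open Scope ring_scope.

(** * Smooth maps *)

(* Meaningful for open [U] only. *)
Fixpoint Ck (R : realType) (V W : normedModType R) (k : nat) (U : set V)
    (f : V -> W) : Prop :=
  if k is k'.+1 then
    (forall x, U x -> differentiable f x) /\
    (forall v, Ck k' U (fun x => 'D_v f x))
  else forall x, U x -> {for x, continuous f}.

Definition smooth_on (R : realType) (V W : normedModType R) (U : set V)
    (f : V -> W) := forall k, Ck k U f.

(** * Charts and Lie groups *)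

(* A homeomorphism between an open subset of [M] and an open subset of [R^n];
   [chart_map] and [chart_inv] are arbitrary outside these subsets. *)
Record chart (R : realType) (n : nat) (M : topologicalType) := Chart {
  chart_dom : set M;
  chart_cod : set 'rV[R]_n;
  chart_map : M -> 'rV[R]_n;
  chart_inv : 'rV[R]_n -> M;
  open_chart_dom : open chart_dom;
  open_chart_cod : open chart_cod;
  chart_map_cod : forall x, chart_dom x -> chart_cod (chart_map x);
  chart_inv_dom : forall u, chart_cod u -> chart_dom (chart_inv u);
  chart_mapK : forall x, chart_dom x -> chart_inv (chart_map x) = x;
  chart_invK : forall u, chart_cod u -> chart_map (chart_inv u) = u;
  continuous_chart_map : {within chart_dom, continuous chart_map};
  continuous_chart_inv : {within chart_cod, continuous chart_inv}
}.

(* As in the usual formalization of manifolds by charted spaces, a preferred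
   chart [chart_at g] is chosen around each point. *)
HB.mixin Record isLieGroup (R : realType) (n : nat) G
    of Topological G & Group G := {
  lie_hausdorff : hausdorff_space G;
  lie_second_countable : @second_countable G;
  atlas : set (chart R n G);
  chart_at : G -> chart R n G;
  chart_at_atlas : forall g, atlas (chart_at g);
  chart_at_dom : forall g, chart_dom (chart_at g) g;
  atlas_compatible : forall a b, atlas a -> atlas b ->
    smooth_on
      [set u : 'rV[R]_n | chart_cod a u /\ chart_dom b (chart_inv a u)]
      (fun u => chart_map b (chart_inv a u));
  lie_mul_continuous : continuous (fun gh : G * G => (gh.1 * gh.2)%g);
  lie_mul_smooth : forall a b c, atlas a -> atlas b -> atlas c ->
    smooth_on
      [set u : 'rV[R]_n * 'rV[R]_n |
        [/\ chart_cod a u.1, chart_cod b u.2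
          & chart_dom c (chart_inv a u.1 * chart_inv b u.2)%g]]
      (fun u => chart_map c (chart_inv a u.1 * chart_inv b u.2)%g);
  lie_inv_continuous : continuous (fun g : G => g^-1%g);
  lie_inv_smooth : forall a b, atlas a -> atlas b ->
    smooth_on
      [set u : 'rV[R]_n | chart_cod a u /\ chart_dom b (chart_inv a u)^-1%g]
      (fun u => chart_map b (chart_inv a u)^-1%g)
}.

#[short(type="lieGroupType")]
HB.structure Definition LieGroup (R : realType) (n : nat) :=
  { G of isLieGroup R n G & Topological G & Group G }.

(** * The Lie algebra of a Lie group *)

Section LieAlgebraOfGroup.
Variables (R : realType) (n : nat) (G : lieGroupType R n).

Definition chart1 : chart R n G := chart_at (1 : G)%g.

Definition coord1 : 'rV[R]_n := chart_map chart1 (1 : G)%g.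

(* The tangent space of [G] at 1 is identified with ['rV[R]_n] through the
   differential of [chart1]; [Ad g] is the differential at 1 of the
   conjugation [h |-> g * h * g^-1]. *)
Definition Ad (g : G) (x : 'rV[R]_n) : 'rV[R]_n :=
  'D_x (fun u => chart_map chart1 (g * chart_inv chart1 u * g^-1)%g) coord1.

(* [x, y] = ad x y, where ad is the differential of Ad at 1. *)
Definition lie_bracket (x y : 'rV[R]_n) : 'rV[R]_n :=
  'D_x (fun u => Ad (chart_inv chart1 u) y) coord1.

Definition is_subgroup (H : set G) :=
  [/\ H 1%g, forall g h, H g -> H h -> H (g * h)%g
    & forall g, H g -> H g^-1%g].

Definition is_compact_subgroup (H : set G) := is_subgroup H /\ compact H.

Definition is_maximal_compact_subgroup (K : set G) :=
  is_compact_subgroup K /\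
  forall H, is_compact_subgroup H -> K `<=` H -> H = K.

(* The Lie algebra of a closed subgroup [H], i.e. the set of all [x] with
   exp(t x) in [H] for all real t: [t |-> exp(t x)] is the one-parameter
   subgroup of [G] with initial velocity [x]. *)
Definition lie_of_subgroup (H : set G) : set 'rV[R]_n :=
  [set x | exists gamma : R -> G,
    [/\ continuous gamma,
        forall s t, gamma (s + t) = (gamma s * gamma t)%g,
        is_derive (0 : R) (1 : R) (fun t => chart_map chart1 (gamma t)) x
      & forall t, H (gamma t)]].

Definition Ad_invariant (H : set G) (A : set 'rV[R]_n) :=
  forall h x, H h -> A x -> A (Ad h x).

Definition fixator (K : set G) (B : set 'rV[R]_n) : set G :=
  [set k | K k /\ forall xi, B xi -> Ad k xi = xi].

End LieAlgebraOfGroup.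

(** * Lie algebras *)

(* Here [br] is the bracket of a Lie algebra structure on ['rV[R]_n]. *)
Section LieAlgebra.
Variables (R : realType) (n : nat).
Variable br : 'rV[R]_n -> 'rV[R]_n -> 'rV[R]_n.

Definition is_subalgebra (s : {vspace 'rV[R]_n}) :=
  forall x y, x \in s -> y \in s -> br x y \in s.

Definition is_abelian (s : {vspace 'rV[R]_n}) :=
  forall x y, x \in s -> y \in s -> br x y = 0.

Definition is_ideal (s : {vspace 'rV[R]_n}) :=
  forall x y, y \in s -> br x y \in s.

(* As [br] is bilinear, this is the span of all [br x y] with x, y in [s]. *)
Definition derived (s : {vspace 'rV[R]_n}) : {vspace 'rV[R]_n} :=
  <<[seq br x y | x <- vbasis s, y <- vbasis s]>>%VS.

Definition is_solvable (s : {vspace 'rV[R]_n}) :=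
  exists m, iter m derived s = 0%VS.

Definition is_semisimple :=
  forall s, is_ideal s -> is_solvable s -> s = 0%VS.

Definition killing (x y : 'rV[R]_n) : R :=
  \tr (lin1_mx (br x) *m lin1_mx (br y)).

Definition is_cartan_involution (theta : {linear 'rV[R]_n -> 'rV[R]_n}) :=
  [/\ forall x y, theta (br x y) = br (theta x) (theta y),
      forall x, theta (theta x) = x
    & forall x, x != 0 -> 0 < - killing x (theta x)].

Definition cartan_k (theta : 'rV[R]_n -> 'rV[R]_n) : set 'rV[R]_n :=
  [set x | theta x = x].

Definition cartan_p (theta : 'rV[R]_n -> 'rV[R]_n) : set 'rV[R]_n :=
  [set x | theta x = - x].

Definition centralizer_in (p B : set 'rV[R]_n) : set 'rV[R]_n :=
  [set eta | p eta /\ forall xi, B xi -> br eta xi = 0].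

Definition orthogonal_in (p B : set 'rV[R]_n) : set 'rV[R]_n :=
  [set eta | p eta /\ forall xi, B xi -> killing eta xi = 0].

End LieAlgebra.

(** * Convex bodies and faces *)

Section Convexity.
Variables (R : realType) (V : normedModType R).

Definition segment (x y : V) : set V :=
  [set (1 - t) *: x + t *: y | t in `[0, 1]%classic].

Definition affine_hull (A : set V) : set V :=
  [set v | exists m (x : 'I_m -> V) (a : 'I_m -> R),
    [/\ forall i, A (x i), \sum_i a i = 1 & v = \sum_i a i *: x i]].

Definition relint (A : set V) : set V :=
  [set x | A x /\ \forall y \near x, affine_hull A y -> A y].

(* The linear subspace [D] such that [affine_hull A = p + D]. *)
Definition direction (A : set V) : set V :=
  [set q - p | p in affine_hull A & q in affine_hull A].

Definition is_convex_body (E : set V) :=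
  [/\ E !=set0, compact E & convex_set E].

Definition is_face (E F : set V) :=
  [/\ F !=set0, convex_set F, F `<=` E
    & forall x y, E x -> E y ->
        relint (segment x y) `&` F !=set0 -> segment x y `<=` F].

End Convexity.

(* Main.v *)
Require Import Defs.
From HB Require Import structures.
From mathcomp Require Import all_boot all_order all_algebra.
From mathcomp Require Import all_classical all_reals all_analysis.
From mathcomp Require Import lra.
Import Order.TTheory GRing.Theory Num.Theory.
Import numFieldNormedType.Exports.
Local Open Scope classical_set_scope.
Local Open Scope ring_scope.

(** The subalgebra [s] is built one vector at a time, along a decreasing
    sequence of convex sets [C] that starts with [E] and ends with [F].  The pair
    [(s, C)] is kept [adapted]: [s] is abelian, [C] lies in the centralizer [p^s]
    and is stable under the fixator [K^s], and the Killing form against any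
    element of [s] is constant on [C].

    As long as [C] is not equal to [F], the set [F] is a proper face of [C], and
    [face_support] gives a linear functional on [p^s] that attains its minimum
    over [C] on the whole of [F] and is not constant on [C].  The Killing form is
    positive definite on [p], so this functional is the product with a vector
    [xi] of [p^s].  The new set [C'] is the set of minimizers and the new
    subalgebra is [s + <[xi]>], which is abelian because [xi] centralizes [s].
    The point is that [C'] lies in the centralizer of [xi]: if [x] is a minimizer,
    then the bracket [a] of [x] and [xi] is fixed by the Cartan involution and
    centralizes [s], so [exp(t a)] lies in [K^s] and preserves [C].  The derivative
    at [0] of the product of [Ad (exp(t a)) x] with [xi] therefore vanishes; by
    invariance it is the product of [a] with itself, and the Killing form is
    negative definite on the fixed points of the involution, so [a = 0]
    ([critical_commute]).  Since the Killing form against [xi] is not constant on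
    [C], the vector [xi] is not in [s]: the dimension of [s] grows at each step and
    the procedure stops.

    The Lie theory that this needs is derived from the smoothness of the group
    operations in the charts: [Ad] is a representation by automorphisms of the
    bracket, and [u |-> Ad u] is differentiable at the identity
    ([diff_Ad]), which gives the Leibniz form of the Jacobi identity
    ([br_leibniz]) and the derivative of [Ad] along a one-parameter subgroup
    ([is_diff_Ad_one_parameter]).  The antisymmetry of the bracket comes for free:
    a square [br x x] acts by zero because of the Leibniz identity, so it is
    in the radical of the Killing form, which a Cartan involution forces to be
    zero. *)

(** * Convex sets and faces *)

Lemma convex_setP {R : realType} {V : lmodType R} {A : set V} : convex_set A <->
  forall x y t, 0 <= t <= 1 -> A x -> A y -> A ((1 - t) *: x + t *: y).
Proof.
split=> [cA x y t /andP[t0 t1] Ax Ay|cA x y t]; last first.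
  rewrite !inE => Ax Ay; have := cA y x t%:inum; rewrite addrC; apply => //.
  by rewrite ge0 le1.
have := cA y x (Itv01 t0 t1); rewrite !inE => /(_ Ay Ax).
by rewrite addrC.
Qed.

(** Parameters in the open unit interval replace the relative interiors of
    segments, so that the face property makes sense in any vector space. *)
Definition extreme_in {R : realType} {V : lmodType R} (C F : set V) :=
  forall x y t, C x -> C y -> 0 < t < 1 -> F ((1 - t) *: x + t *: y) -> F x.

Section Faces.
Context {R : realType} {V : normedModType R}.
Implicit Types E F : set V.

Lemma segmentE (x y : V) t : (1 - t) *: x + t *: y = x + t *: (y - x).
Proof. by rewrite scalerBl scale1r scalerBr addrA addrAC. Qed.

Lemma affine_hull_segment (x y v : V) : affine_hull (segment x y) v ->
  exists r, v = x + r *: (y - x).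
Proof.
move=> [m [z [a [zxy a1 ->]]]].
have /choice[r rE] : forall i, exists r : R, z i = x + r *: (y - x).
  by move=> i; have [t _ <-] := zxy i; exists t; rewrite segmentE.
exists (\sum_i a i * r i).
under eq_bigr do rewrite rE scalerDr scalerA.
by rewrite big_split /= -!scaler_suml a1 scale1r.
Qed.

Lemma segment_relint (x y : V) t : 0 < t < 1 ->
  relint (segment x y) ((1 - t) *: x + t *: y).
Proof.
move=> /andP[t0 t1]; split.
  by exists t => //=; rewrite in_itv /= !ltW.
have [->|xy] := eqVneq x y.
  near=> v => /affine_hull_segment[r ->].
  rewrite subrr scaler0 addr0; exists 0; first by rewrite /= in_itv /= lexx ler01.
  by rewrite subr0 scale1r scale0r addr0.
have xy0 : 0 < `|y - x| by rewrite normr_gt0 subr_eq0 eq_sym.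
(* A point [x + r *: (y - x)] closer than [d] has [r] between [0] and [1]. *)
pose d := Num.min t (1 - t) * `|y - x|.
have d0 : 0 < d by rewrite mulr_gt0 // lt_min t0 subr_gt0.
near=> v => /affine_hull_segment[r vE].
have : `|(1 - t) *: x + t *: y - v| < d.
  near: v; apply/nbhs_ballP; exists d => //= z.
  by rewrite -ball_normE.
rewrite vE segmentE opprD addrACA subrr add0r -scalerBl.
rewrite normrZ ltr_pM2r // lt_min !ltr_norml => /andP[/andP[h1 h2] /andP[h3 h4]].
exists r; first by rewrite /= in_itv /=; apply/andP; split; lra.
by rewrite segmentE.
Unshelve. all: by end_near. Qed.

Lemma face_extreme {E F} : is_face E F -> extreme_in E F.
Proof.
move=> [_ _ _ face] x y t Ex Ey t01 Fz.
apply: (face x y Ex Ey).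
  by exists ((1 - t) *: x + t *: y); split=> //; exact: segment_relint.
exists 0; first by rewrite /= in_itv /= lexx ler01.
by rewrite subr0 scale1r scale0r addr0.
Qed.

End Faces.

(** * Supporting functionals of faces *)

(** Finitely many points of [P] span its linear hull: a family of points of [P]
    of maximal rank does. *)
Lemma exists_spanning_seq {R : realType} {V : vectType R} (P : set V) :
  exists2 s : seq V, (forall x, x \in s -> P x) &
                     forall x, P x -> x \in << s >>%VS.
Proof.
pose dims k := `[< exists2 s, (forall x, x \in s -> P x) & \dim << s >> = k >].
have dims0 : exists k, dims k by exists (\dim <<([::] : seq V)>>);
  apply/asboolP; exists [::].
have dims_ub k : dims k -> (k <= \dim {:V})%N.
  by move=> /asboolP[s _ <-]; apply: dimvS; exact: subvf.
have [k /asboolP[s sP sk] kmax] := ex_maxnP dims0 dims_ub.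
exists s => // x Px; apply: contraT => xs.
have /kmax : dims (\dim <<x :: s>>).
  apply/asboolP; exists (x :: s) => // y; rewrite inE => /orP[/eqP->//|]; exact: sP.
rewrite -sk leqNgt span_cons; case/negP.
have sxs : (<< s >> <= <[x]> + << s >>)%VS by exact: addvSr.
rewrite ltn_neqAle dimvS // andbT; apply: contraNneq xs => dimE.
have /eqP -> : (<< s >> == <[x]> + << s >>)%VS by rewrite eqEdim sxs dimE leqnn.
by apply: (subvP (addvSl _ _)); exact: memv_line.
Qed.

Lemma exists_vspace {R : realType} {V : vectType R} (P : set V) :
  P 0 -> (forall a x y, P x -> P y -> P (a *: x + y)) ->
  exists W : {vspace V}, forall x, x \in W <-> P x.
Proof.
move=> P0 PD; have [s sP Ps] := exists_spanning_seq P.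
exists << s >>%VS => x; split=> [xs|]; last exact: Ps.
rewrite (coord_span (X := in_tuple s) xs); apply: (big_rec P) => // i y _ Py.
by apply: PD => //; apply: sP; exact: mem_nth.
Qed.

Section Separation.
Context {R : realType} {V : vectType R}.
Variable B : {biscalar V}.
Implicit Types (U W : {vspace V}) (P : set V).

Definition posdef_on W := forall x, x \in W -> x != 0 -> 0 < B x x.

(** Since [B] is positive definite on [U], the orthogonal of [U] in [W] is a
    complement of [U]; a multiple of the component of [e] in it is the vector
    wanted. *)
Lemma dual_vector U W e : posdef_on W -> (U <= W)%VS -> e \in W -> e \notin U ->
  exists2 xi, xi \in W & (forall x, x \in U -> B x xi = 0 :> R) /\ B e xi = 1 :> R.
Proof.
move=> posW UW eW eU.
pose f xi := \row_(i < \dim U) B (vbasis U)`_i xi.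
have f_lin : linear f.
  by move=> k x y; apply/rowP => i; rewrite !mxE linearPr.
pose fL : {linear V -> 'rV[R]_(\dim U)} := HB.pack f (GRing.isLinear.Build _ _ _ _ f f_lin).
pose N := (W :&: lker (linfun fL))%VS.
have Northo nu x : nu \in N -> x \in U -> B x nu = 0 :> R.
  rewrite memv_cap memv_ker lfunE /= => /andP[_ /eqP fnu] xU.
  rewrite (coord_vbasis xU) linear_sumlz big1 // => i _.
  by rewrite linearZl_LR; move/rowP: fnu => /(_ i); rewrite !mxE => ->; rewrite mulr0.
have NU0 : (N :&: U = 0)%VS.
  apply/eqP; rewrite -subv0; apply/subvP => x; rewrite memv_cap memv0 => /andP[xN xU].
  apply: contraT => x0; have := posW x (subvP UW _ xU) x0.
  by rewrite Northo // ltxx.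
have WE : (N + U = W)%VS.
  apply/eqP; rewrite eqEdim subv_add capvSl UW /=.
  rewrite dimv_disjoint_sum // -(limg_ker_dim (linfun fL) W) leq_add2l.
  by rewrite (leq_trans (dimvS (subvf _))) // dimvf /dim /= mul1n.
move: eW eU; rewrite -WE => /memv_addP[nu nuN [x xU ->]] eU.
have nuW : nu \in W by move: nuN; rewrite memv_cap => /andP[].
have nu0 : nu != 0 by apply: contraNneq eU => ->; rewrite add0r.
have nn := posW _ nuW nu0.
exists ((B nu nu)^-1 *: nu); first by rewrite -WE in nuW *; rewrite memvZ.
split=> [y yU|]; rewrite linearZr_LR /=; first by rewrite (Northo nu y) // mulr0.
by rewrite linearDl /= (Northo _ _ nuN xU) addr0 mulVf // gt_eqF.
Qed.

Lemma separating_real (S T : set R) : S !=set0 -> T !=set0 ->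
  (forall s t, S s -> T t -> s <= t) ->
  exists a, (forall s, S s -> s <= a) /\ (forall t, T t -> a <= t).
Proof.
move=> S0 [t0 Tt0] ST; exists (sup S); split=> [s Ss|t Tt].
  by apply: ub_le_sup => //; exists t0 => x Sx; exact: ST.
by apply: ge_sup => // x Sx; exact: ST.
Qed.

Definition is_cone P :=
  (forall x y, P x -> P y -> P (x + y)) /\
  (forall a x, 0 <= a -> P x -> P (a *: x)).

(** The extension theorem of M. Riesz in finite dimension, with functionals
    represented by vectors of [W]: the form is extended one vector [e] at a time,
    and its value at [e] has to separate the lower bounds imposed by the points
    [x + e] of the cone from the upper bounds imposed by its points [x - e].  Both
    families are nonempty because [u] is an order unit of [W]. *)
Lemma riesz_extension P W u : is_cone P -> posdef_on W -> u \in W -> P u ->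
  ~ P (- u) -> (forall x, x \in W -> exists2 t, 0 <= t & P (t *: u + x)) ->
  exists2 xi, xi \in W & 0 < B u xi /\ forall x, x \in W -> P x -> 0 <= B x xi.
Proof.
move=> [PD PZ] posW uW Pu PNu unit.
suff main s : {subset s <= W} -> exists2 xi, xi \in W & 0 < B u xi /\
    forall x, x \in << s ++ [:: u]>>%VS -> P x -> 0 <= B x xi.
  have [|xi xiW [uxi xiP]] := main (vbasis W); first by move=> x; exact: vbasis_mem.
  exists xi => //; split=> // x xW; apply: xiP.
  rewrite span_cat; apply: (subvP (addvSl _ _)).
  by rewrite (span_basis (vbasisP W)).
elim: s => [_|e s IH sW].
  have u0 : u != 0.
    by apply/eqP => u0; apply: PNu; rewrite u0 oppr0 -u0.
  (* On the line of [u], the form [B _ u] is nonnegative on the cone. *)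
  exists u => //; split; first exact: posW.
  move=> x; rewrite span_seq1 => /vlineP[k ->] Pku.
  rewrite linearZl_LR /= mulr_ge0 //; last by rewrite ltW // posW.
  rewrite leNgt; apply/negP => k0; apply: PNu.
  have := PZ (- k)^-1 _ _ Pku; rewrite invr_ge0 oppr_ge0 ltW //.
  rewrite scalerA invrN mulNr mulVf ?lt_eqF // scaleN1r; exact.
have [|xi0 xi0W [uxi0 xi0P]] := IH; first by move=> x xs; apply: sW; rewrite inE xs orbT.
have eW : e \in W by apply: sW; rewrite mem_head.
set U := << s ++ [:: u]>>%VS in xi0P.
have UW : (U <= W)%VS.
  apply/span_subvP => x; rewrite mem_cat inE => /orP[xs|/eqP-> //].
  by apply: sW; rewrite inE xs orbT.
have uU : u \in U by apply: memv_span; rewrite mem_cat mem_head orbT.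
rewrite cat_cons span_cons -/U.
have [eU|eU] := boolP (e \in U).
  by exists xi0 => //; rewrite (addv_idPr _) // -memvE.
have [eta etaW [etaU etae]] := dual_vector U W e posW UW eW eU.
have [a [aS aT]] : exists a,
    (forall r, [set - B x xi0 | x in [set x | x \in U /\ P (x + e)]] r -> r <= a) /\
    (forall r, [set B x xi0 | x in [set x | x \in U /\ P (x - e)]] r -> a <= r).
  apply: separating_real.
  - have [t _ Pt] := unit e eW.
    by exists (- B (t *: u) xi0), (t *: u) => //; split=> //; rewrite memvZ.
  - have [|t _ Pt] := unit (- e); first by rewrite memvN.
    by exists (B (t *: u) xi0), (t *: u) => //; split=> //; rewrite memvZ.
  - move=> _ _ [x [xU Px] <-] [y [yU Py] <-].
    rewrite -subr_ge0 opprK -linearDl /= addrC; apply: xi0P; first by rewrite memvD.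
    by have := PD _ _ Px Py; rewrite addrACA subrr addr0.
pose xi := xi0 + (a - B e xi0) *: eta.
have xiU x : x \in U -> B x xi = B x xi0.
  by move=> xU; rewrite linearDr linearZr_LR /= etaU // mulr0 addr0.
have xie : B e xi = a.
  by rewrite linearDr linearZr_LR /= etae mulr1 addrC subrK.
exists xi; first by rewrite memvD // memvZ.
split; first by rewrite xiU.
move=> _ /memv_addP[_ /vlineP[k ->] [x xU ->]] Pkx.
rewrite linearDl linearZl_LR /= xie xiU //.
have [k0|k0|k0] := ltgtP k 0; last first.
- by rewrite k0 mul0r add0r; apply: xi0P => //; move: Pkx; rewrite k0 scale0r add0r.
- have Pk : P (k^-1 *: x + e).
    have := PZ k^-1 _ _ Pkx; rewrite invr_ge0 ltW // => /(_ isT).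
    by rewrite scalerDr scalerA mulVf ?gt_eqF // scale1r addrC.
  have : - B (k^-1 *: x) xi0 <= a.
    by apply: aS; exists (k^-1 *: x) => //; split=> //; rewrite memvZ.
  rewrite linearZl_LR /= -(ler_pM2l k0) mulrN mulrA mulfV ?gt_eqF // mul1r => h.
  by rewrite -subr_ge0 opprK in h.
- have Nk0 : 0 < - k by rewrite oppr_gt0.
  have Pk : P ((- k)^-1 *: x - e).
    have := PZ (- k)^-1 _ _ Pkx; rewrite invr_ge0 ltW // => /(_ isT).
    by rewrite scalerDr scalerA invrN mulNr mulVf ?lt_eqF // scaleN1r addrC.
  have : a <= B ((- k)^-1 *: x) xi0.
    by apply: aT; exists ((- k)^-1 *: x) => //; split=> //; rewrite memvZ.
  rewrite linearZl_LR /= -(ler_pM2l Nk0) mulrA mulfV ?gt_eqF // mul1r => h.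
  by rewrite -subr_ge0 mulNr opprK addrC in h.
Qed.

(** On the linear hull of the cone, the sum [u] of a spanning family of elements
    of [P] is an order unit, so that [riesz_extension] applies there: if [- u] were
    in [P], then [P] would be its whole linear hull and contain [- v]. *)
Lemma cone_support P W v : is_cone P -> posdef_on W -> (forall x, P x -> x \in W) ->
  P v -> ~ P (- v) ->
  exists2 xi, xi \in W & (forall x, P x -> 0 <= B x xi) /\
                         exists2 x, P x & 0 < B x xi.
Proof.
move=> Pcone posW PW Pv PNv; have [PD PZ] := Pcone.
have P0 : P 0 by rewrite -(scale0r v); exact: PZ.
have [s sP Ps] := exists_spanning_seq P.
pose u := \sum_(i < size s) s`_i.
have Psum (c : 'I_(size s) -> R) : (forall i, 0 <= c i) -> P (\sum_i c i *: s`_i).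
  move=> c0; apply: (big_ind P) => [||i _]; [exact: P0|exact: PD|].
  by apply: PZ => //; apply: sP; exact: mem_nth.
have Pu : P u.
  have := Psum (fun=> 1) (fun=> ler01).
  by under eq_bigr do rewrite scale1r.
have unit x : x \in << s >>%VS -> exists2 t, 0 <= t & P (t *: u + x).
  move=> xs; pose c i := coord (in_tuple s) i x.
  (* The coordinates of [t *: u + x] are [t + c i]. *)
  exists (\sum_i `|c i|); first exact: sumr_ge0.
  rewrite (coord_span (X := in_tuple s) xs) scaler_sumr -big_split /=.
  under eq_bigr do rewrite -scalerDl.
  apply: Psum => i; rewrite (bigD1 i) //= addrAC addr_ge0 ?sumr_ge0 //.
  by rewrite -lerBlDr sub0r -normrN ler_norm.
have PNu : ~ P (- u).
  move=> PNu; apply: PNv.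
  have [|t t0 Pt] := unit (- v); first by rewrite memvN; exact: Ps.
  by have := PD _ _ Pt (PZ _ _ t0 PNu); rewrite scalerN addrAC subrr add0r.
have sW : (<< s >> <= W)%VS by apply/span_subvP => x xs; apply: PW; exact: sP.
have poss : posdef_on << s >> by move=> x xs; apply: posW; exact: subvP sW _ xs.
have [xi xis [uxi xiP]] := riesz_extension P _ u Pcone poss (Ps _ Pu) Pu PNu unit.
exists xi; first exact: subvP sW _ xis.
split; last by exists u.
by move=> x Px; apply: xiP => //; exact: Ps.
Qed.

Lemma convex_set_mean (A : set V) x y r s : convex_set A -> A x -> A y ->
  0 <= r -> 0 <= s -> 0 < r + s -> A ((r + s)^-1 *: (r *: x + s *: y)).
Proof.
move=> /convex_setP Aconv Ax Ay r0 s0 rs0.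
have -> : (r + s)^-1 *: (r *: x + s *: y) =
    (1 - s / (r + s)) *: x + (s / (r + s)) *: y.
  rewrite scalerDr !scalerA -[X in X - _](mulfV (lt0r_neq0 rs0)) -mulrBl addrK.
  by rewrite mulrC [_^-1 * s]mulrC.
apply: Aconv => //; rewrite divr_ge0 //=; last exact: ltW.
by rewrite ler_pdivrMr // mul1r lerDr.
Qed.

(** The differences [c - f] of points of [C] and [F] generate a convex cone.  It
    is not a linear subspace: if it contained the opposite of [c0 - f0], then a
    point of [F] would lie strictly between [c0] and another point of [C], and [c0]
    would belong to [F].  A form that supports this cone attains its
    minimum over [C] on [F]. *)
Lemma face_support (W : {vspace V}) (C F : set V) :
  posdef_on W -> (forall x, C x -> x \in W) -> convex_set C -> convex_set F ->
  F !=set0 -> F `<=` C -> extreme_in C F -> ~ (C `<=` F) ->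
  exists2 xi, xi \in W & (forall x f, C x -> F f -> B f xi <= B x xi) /\
     exists x f, [/\ C x, F f & B f xi < B x xi].
Proof.
move=> posW CW Cconv Fconv [f0 Ff0] FC Fface CNF.
have [c0 Cc0 NFc0] : exists2 c, C c & ~ F c.
  by apply: contrapT => h; apply: CNF => x Cx; apply: contrapT => NFx; apply: h; exists x.
pose P : set V := [set z | exists t c f, [/\ 0 <= t, C c, F f & z = t *: (c - f)]].
have Pcone : is_cone P.
  split=> [_ _ [r [c [f [r0 Cc Ff ->]]]] [s [c' [f' [s0 Cc' Ff' ->]]]]|]; last first.
    move=> a _ a0 [r [c [f [r0 Cc Ff ->]]]]; exists (a * r), c, f.
    by rewrite scalerA mulr_ge0.
  have [rs0|rs0] := ltP 0 (r + s); last first.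
    exists 0, c, f; split=> //.
    have /andP[/eqP-> /eqP->] : (r == 0) && (s == 0).
      by rewrite -paddr_eq0 // eq_le rs0 addr_ge0.
    by rewrite !scale0r addr0.
  exists (r + s), ((r + s)^-1 *: (r *: c + s *: c')), ((r + s)^-1 *: (r *: f + s *: f')).
  split; [by rewrite ltW | exact: convex_set_mean | exact: convex_set_mean |].
  rewrite -scalerBr scalerA mulfV ?gt_eqF // scale1r !scalerBr opprD.
  by rewrite addrACA.
have PW x : P x -> x \in W.
  move=> [r [c [f [_ Cc Ff ->]]]]; rewrite memvZ // memvB //; apply: CW => //; exact: FC.
have Pv : P (c0 - f0) by exists 1, c0, f0; rewrite ler01 scale1r.
have PNv : ~ P (- (c0 - f0)).
  move=> [t [c1 [f1 [t0 Cc1 Ff1 E]]]]; apply: NFc0.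
  have t1 : 0 < 1 + t by rewrite ltr_pwDl.
  have [t00|tn0] := eqVneq t 0.
    by move: E; rewrite t00 scale0r => /eqP; rewrite oppr_eq0 subr_eq0 => /eqP->.
  apply: (Fface c0 c1 (t / (1 + t))) => //.
    have tgt0 : 0 < t by rewrite lt0r tn0 t0.
    by rewrite divr_gt0 //= ltr_pdivrMr // mul1r ltrDr ltr01.
  have -> : (1 - t / (1 + t)) *: c0 + (t / (1 + t)) *: c1 =
      (1 + t)^-1 *: (1 *: f0 + t *: f1).
    have -> : 1 - t / (1 + t) = (1 + t)^-1.
      by rewrite -[X in X - _](mulfV (lt0r_neq0 t1)) -mulrBl addrK mul1r.
    rewrite scale1r mulrC -scalerA -scalerDr; congr (_ *: _).
    move: E; rewrite opprB scalerBr => /eqP; rewrite subr_eq addrAC.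
    by rewrite eq_sym subr_eq addrC => /eqP->; rewrite addrC.
  by apply: convex_set_mean.
have [xi xiW [xiP [_ [t [c [f [t0 Cc Ff ->]]]] xi0]]] := cone_support P W _ Pcone posW PW Pv PNv.
exists xi => //; split=> [x g Cx Fg|].
  rewrite -subr_ge0 -linearBl /=; apply: xiP.
  by exists 1, x, g; rewrite ler01 scale1r.
exists c, f; split=> //; rewrite -subr_gt0 -linearBl /=.
move: xi0; rewrite linearZl_LR /= => xi0.
by rewrite ltNge; apply/negP => h; move: xi0; rewrite ltNge mulr_ge0_le0.
Qed.

End Separation.

(** * Differentials *)

Lemma differentiable_near {R : realType} {V W : normedModType R} {f g : V -> W} {x} :
  (\near x, f x = g x) -> differentiable f x -> differentiable g x.
Proof.
move=> fg df; have /diff_locallyP[dfc /eqaddoP dfx] := df.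
have gx : g \o shift x = cst (g x) + 'd f x +o_ 0 id.
  apply/eqaddoP => eps eps0; near=> h.
  have -> : ((g \o shift x) - (cst (g x) + 'd f x)) h =
            ((f \o shift x) - (cst (f x) + 'd f x)) h.
    rewrite -![(_ - _ : _ -> _) _]/(_ - _) /= -!(nbhs_singleton fg).
    congr (_ - _); apply/esym; near: h.
    have := fg; rewrite (near_shift 0) => fg0; near=> h.
    have : f ((shift (x - 0)) h) = g ((shift (x - 0)) h) by near: h.
    by rewrite subr0.
  by near: h; apply: dfx.
by apply/diff_locallyP; rewrite (diff_unique dfc gx).
Unshelve. all: by end_near. Qed.

Lemma diff_scale {R : realType} {n} {V : normedModType R} (k : V -> R) (f : V -> 'rV[R]_n) x :
  differentiable k x -> differentiable f x ->
  differentiable (fun z => k z *: f z) x.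
Proof.
move=> dk df.
have -> : (fun z => k z *: f z) =
    \sum_(j < n) (fun z => (k z * f z 0 j) *: (delta_mx 0 j : 'rV[R]_n)).
  rewrite funeqE => z; rewrite fct_sumE {1}(row_sum_delta (f z)) scaler_sumr.
  by apply: eq_bigr => j _; rewrite scalerA.
apply: differentiable_sum => j; apply: differentiableZl.
apply: (@differentiableM _ _ k (fun z => f z 0 j)) => //.
apply: (@differentiable_comp _ _ _ _ f (fun M : 'rV[R]_n => M 0 j)) => //.
exact: differentiable_coord.
Qed.

Lemma diff_fst_sum {R : realType} {n} {V : normedModType R} {f : 'rV[R]_n * 'rV[R]_n -> V} {p} y :
  differentiable f p ->
  'd f p (y, 0) = \sum_(j < n) y 0 j *: 'D_(delta_mx 0 j, 0) f p.
Proof.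
move=> df.
have -> : (y, 0) = \sum_(j < n) y 0 j *: (delta_mx 0 j, 0) :> 'rV[R]_n * 'rV[R]_n.
  rewrite [RHS]surjective_pairing; congr (_, _).
    by rewrite {1}(row_sum_delta y) (big_morph fst (id1 := 0) (op1 := +%R)).
  rewrite (big_morph snd (id1 := 0) (op1 := +%R)) //.
  by rewrite big1 // => j _ /=; rewrite scaler0.
rewrite linear_sum; apply: eq_bigr => j _.
by rewrite linearZ (deriveE _ df).
Qed.

Lemma near_is_diff_unique {R : realType} {V W : normedModType R} {f g df dg : V -> W} {x} :
  (\near x, f x = g x) -> is_diff x f df -> is_diff x g dg -> df =1 dg.
Proof.
move=> fg [df1 dfE] [dg1 dgE] v; rewrite -dfE -dgE -(deriveE v df1) -(deriveE v dg1).
exact: near_eq_derive.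
Qed.

Lemma is_diff_near {R : realType} {V W : normedModType R} {f g df : V -> W} {x} :
  (\near x, f x = g x) -> is_diff x f df -> is_diff x g df.
Proof.
move=> fg df1; have dg := differentiable_near fg (ex_diff (is_diff_def := df1)).
apply: DiffDef => //; apply/funext => v; apply/esym.
exact: (near_is_diff_unique fg df1 (differentiableP dg)).
Qed.

Lemma is_diff_linear_rV {R : realType} {n} {W : normedModType R}
  (f : {linear 'rV[R]_n -> W}) x : is_diff x f f.
Proof.
have fE : f = \sum_(j < n) (fun x : 'rV[R]_n => x 0 j *: f (delta_mx 0 j)) :> (_ -> _).
  apply/funext => y; rewrite fct_sumE {1}(row_sum_delta y) linear_sum.
  by apply: eq_bigr => j _; rewrite linearZ.
have fd y : differentiable f y.
  rewrite fE; apply: differentiable_sum => j; apply: differentiableZl.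
  exact: differentiable_coord.
apply: DiffDef => //; apply: diff_lin => y; exact: differentiable_continuous.
Qed.

Lemma is_diff_bilinear_rV {R : realType} {n m}
  (f : {bilinear 'rV[R]_n -> 'rV[R]_n -> 'rV[R]_m}) p :
  is_diff p (fun q => f q.1 q.2) (fun q => f p.1 q.2 + f q.1 p.2).
Proof.
have fE : (fun q => f q.1 q.2) = \sum_(j < n) (fun q : 'rV[R]_n * 'rV[R]_n =>
    q.1 0 j *: f (delta_mx 0 j) q.2).
  apply/funext => -[y z] /=; rewrite fct_sumE {1}(row_sum_delta y) linear_sumlz.
  by apply: eq_bigr => j _; rewrite linearZl_LR.
have fd q : differentiable (fun q => f q.1 q.2) q.
  rewrite fE; apply: differentiable_sum => j; apply: diff_scale.
    apply: (@differentiable_comp _ _ _ _ fst (fun N : 'rV[R]_n => N 0 j)).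
      apply: linear_differentiable => ?; exact: cvg_fst.
    exact: differentiable_coord.
  apply: (@differentiable_comp _ _ _ _ snd (f (delta_mx 0 j))).
    apply: linear_differentiable => ?; exact: cvg_snd.
  have [] // := is_diff_linear_rV (f (delta_mx 0 j)) q.2.
apply: DiffDef => //; apply: diff_bilin => y; exact: differentiable_continuous.
Qed.

Lemma is_diff0_cst {R : realType} {n} (f : R -> 'rV[R]_n) s t :
  (forall t, is_diff t f (fun=> 0)) -> f s = f t.
Proof.
move=> df; apply/rowP => j.
apply: (@is_derive_0_is_cst R (fun t => f t 0 j) s t) => u.
have d1 := is_diff_comp (df u) (differentiableP (differentiable_coord (f u) 0 j)).
have d2 := ex_diff (is_diff_def := d1).
apply: DeriveDef; first exact: diff_derivable d2.
by rewrite (deriveE (1 : R) d2) (diff_val (is_diff_def := d1)) /= linear0.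
Qed.

(** * The adjoint representation *)

Section Adjoint.
Context {R : realType} {n : nat} {G : lieGroupType R n}.
Implicit Types (c : chart R n G) (g h : G).

Lemma chart_inv_cts c u : chart_cod c u -> {for u, continuous (chart_inv c)}.
Proof.
move=> cu.
have := @continuous_chart_inv _ _ _ c.
rewrite continuous_open_subspace; last exact: open_chart_cod.
by apply; rewrite inE.
Qed.

Lemma mulgl_cts g : continuous (fun h : G => (g * h)%g).
Proof.
move=> h.
apply: (@continuous_comp _ _ _ (fun h => (g, h)) (fun gh : G * G => (gh.1 * gh.2)%g)).
  by apply: cvg_pair; [exact: cvg_cst | exact: cvg_id].
exact: lie_mul_continuous.
Qed.

Lemma mulgr_cts g : continuous (fun h : G => (h * g)%g).
Proof.
move=> h.
apply: (@continuous_comp _ _ _ (fun h => (h, g)) (fun gh : G * G => (gh.1 * gh.2)%g)).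
  by apply: cvg_pair; [exact: cvg_id | exact: cvg_cst].
exact: lie_mul_continuous.
Qed.

Local Notation e := (coord1 G).
Local Notation q := (chart1 G).

Lemma chart1_dom1 : chart_dom q 1%g. Proof. exact: chart_at_dom. Qed.
Lemma coord1_cod : chart_cod q e. Proof. exact: chart_map_cod chart1_dom1. Qed.
Lemma chart_inv_coord1 : chart_inv q e = 1%g.
Proof. exact: chart_mapK chart1_dom1. Qed.

Lemma near_coord1 (f : G -> G) (O : set G) : continuous f -> open O ->
  O (f 1%g) -> \forall u \near e, O (f (chart_inv q u)).
Proof.
move=> fc Oo O1.
have : {for e, continuous (f \o chart_inv q)}.
  by apply: continuous_comp; [exact: chart_inv_cts coord1_cod | exact: fc].
by apply; apply: open_nbhs_nbhs; split => //=; rewrite chart_inv_coord1.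
Qed.

Lemma near_coord1_cod : \forall u \near e, chart_cod q u.
Proof. by apply: open_nbhs_nbhs; split; [exact: open_chart_cod|exact: coord1_cod]. Qed.

(** Multiplication and inversion read in charts. *)
Definition mul_in (a b c : chart R n G) (u : 'rV[R]_n * 'rV[R]_n) :=
  chart_map c (chart_inv a u.1 * chart_inv b u.2)%g.

Lemma diff_mul_in a b c u : atlas a -> atlas b -> atlas c ->
  chart_cod a u.1 -> chart_cod b u.2 ->
  chart_dom c (chart_inv a u.1 * chart_inv b u.2)%g ->
  differentiable (mul_in a b c) u.
Proof.
move=> ha hb hc au bu cu.
by have /= [+ _] := lie_mul_smooth _ _ _ ha hb hc 1; apply.
Qed.

Lemma diff_derive_mul_in a b c u w : atlas a -> atlas b -> atlas c ->
  chart_cod a u.1 -> chart_cod b u.2 ->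
  chart_dom c (chart_inv a u.1 * chart_inv b u.2)%g ->
  differentiable (fun u => 'D_w (mul_in a b c) u) u.
Proof.
move=> ha hb hc au bu cu.
by have /= [_ /(_ w) [+ _]] := lie_mul_smooth _ _ _ ha hb hc 2; apply.
Qed.

Definition inv_in (a b : chart R n G) (u : 'rV[R]_n) :=
  chart_map b (chart_inv a u)^-1%g.

Lemma diff_inv_in a b u : atlas a -> atlas b -> chart_cod a u ->
  chart_dom b (chart_inv a u)^-1%g -> differentiable (inv_in a b) u.
Proof.
move=> ha hb au bu.
by have /= [+ _] := lie_inv_smooth _ _ ha hb 1; apply.
Qed.

Lemma atlas1 : atlas q. Proof. exact: chart_at_atlas. Qed.

Definition conj_in g (u : 'rV[R]_n) := chart_map q (g * chart_inv q u * g^-1)%g.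

Lemma conj_in1 g : conj_in g e = e.
Proof. by rewrite /conj_in chart_inv_coord1 mulg1 mulgV. Qed.

(** As [g] may be far from the identity, conjugation by [g] is factored through
    charts at [g] and at its inverse. *)
Lemma diff_conj_in g : differentiable (conj_in g) e.
Proof.
pose a := chart_at g; pose b := chart_at g^-1%g.
have ag : chart_dom a g := chart_at_dom g.
have bg : chart_dom b g^-1%g := chart_at_dom g^-1%g.
pose f u := mul_in a b q (mul_in a q a (chart_map a g, u), chart_map b g^-1%g).
apply: (@differentiable_near _ _ _ f).
  near=> u.
  have ? : chart_dom a (g * chart_inv q u)%g.
    near: u; apply: (near_coord1 (fun h => g * h)%g); first exact: mulgl_cts.
      exact: open_chart_dom.
    by rewrite mulg1.
  by rewrite /f /mul_in /= !chart_mapK.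
apply: (@differentiable_comp _ _ _ _ (fun u => (mul_in a q a (chart_map a g, u), chart_map b g^-1%g))).
  apply: differentiable_pair => //.
  apply: (@differentiable_comp _ _ _ _ (fun u => (chart_map a g, u))).
    exact: differentiable_pair.
  apply: diff_mul_in => /=; try exact: chart_at_atlas.
  - exact: chart_map_cod.
  - exact: coord1_cod.
  - by rewrite chart_inv_coord1 chart_mapK // mulg1.
apply: diff_mul_in => /=; try exact: chart_at_atlas; try exact: atlas1.
- by rewrite /mul_in /= chart_inv_coord1 chart_mapK // mulg1; exact: chart_map_cod.
- exact: chart_map_cod.
- rewrite /mul_in /= chart_inv_coord1 chart_mapK // mulg1 !chart_mapK // mulgV.
  exact: chart1_dom1.
Unshelve. all: by end_near. Qed.

Lemma AdE g x : Ad g x = 'd (conj_in g) e x.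
Proof. exact: (deriveE _ (diff_conj_in g)). Qed.

Lemma Ad_is_linear g : linear (@Ad R n G g).
Proof. by move=> k x y; rewrite !AdE linearP. Qed.

HB.instance Definition _ g :=
  GRing.isLinear.Build R 'rV[R]_n 'rV[R]_n *:%R (@Ad R n G g) (@Ad_is_linear g).

Lemma Ad1 x : Ad (1%g : G) x = x.
Proof.
rewrite /Ad (@near_eq_derive _ _ _ _ id) ?derive_id//.
near=> u; rewrite invg1 mul1g mulg1 chart_invK //.
by near: u; apply: near_coord1_cod.
Unshelve. all: by end_near. Qed.

Lemma near_conj_dom g : \forall u \near e, chart_dom q (g * chart_inv q u * g^-1)%g.
Proof.
apply: (near_coord1 (fun h => g * h * g^-1)%g).
- move=> h; apply: (@continuous_comp _ _ _ (fun h => g * h)%g (fun h => h * g^-1)%g).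
    exact: mulgl_cts.
  exact: mulgr_cts.
- exact: open_chart_dom.
- by rewrite mulg1 mulgV; exact: chart1_dom1.
Qed.

(** The chain rule: conjugation by [g * h] is the composite of the two
    conjugations, which both fix the identity. *)
Lemma AdM g h x : Ad (g * h)%g x = Ad g (Ad h x).
Proof.
have dh := differentiableP (diff_conj_in h).
have dg : is_diff (conj_in h e) (conj_in g) ('d (conj_in g) e).
  by rewrite conj_in1; exact: differentiableP (diff_conj_in g).
have [dgh dghE] := is_diff_comp dh dg.
transitivity ('D_x (conj_in g \o conj_in h) e).
  apply: near_eq_derive; near=> u.
  rewrite /conj_in /= chart_mapK; last by near: u; exact: near_conj_dom.
  by rewrite invgM !mulgA.
by rewrite (deriveE x dgh) dghE /= -!AdE.
Unshelve. all: by end_near. Qed.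

Let M := mul_in q q q.
Let i := inv_in q q.

(** Conjugation by [u] in the chart is [v |-> M (M (u, v), i u)], so the chain
    rule writes [Ad u w] through derivatives of [M] in fixed directions, which are
    smooth functions of [u]. *)
Lemma Ad_chartE w : \forall u \near e, Ad (chart_inv q u) w =
  \sum_(j < n) 'D_(0, w) M (u, e) 0 j *: 'D_(delta_mx 0 j, 0) M (u, i u).
Proof.
near=> u.
have cu : chart_cod q u by near: u; exact: near_coord1_cod.
have du : chart_dom q (chart_inv q u) by exact: chart_inv_dom.
have iu : chart_dom q (chart_inv q u)^-1%g.
  near: u; apply: (near_coord1 (fun h => h^-1)%g).
  - exact: lie_inv_continuous.
  - exact: open_chart_dom.
  - by rewrite invg1; exact: chart1_dom1.
have ciu : chart_cod q (i u) by exact: chart_map_cod.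
have Mue : M (u, e) = u.
  by rewrite /M /mul_in /= chart_inv_coord1 mulg1 chart_invK.
have dM1 : differentiable M (u, e).
  apply: diff_mul_in => //=; try exact: atlas1; first exact: coord1_cod.
  by rewrite chart_inv_coord1 mulg1.
have dM2 : differentiable M (u, i u).
  apply: diff_mul_in => //=; try exact: atlas1.
  by rewrite /i /inv_in chart_mapK // mulgV; exact: chart1_dom1.
have D1 := differentiableP dM1.
have D2 : is_diff (M (u, e), i u) M ('d M (u, i u)).
  by rewrite Mue; exact: differentiableP dM2.
have P1 := is_diff_pair (is_diff_cst u e) (is_diff_id e).
have C1 := is_diff_comp P1 D1.
have P2 := is_diff_pair C1 (is_diff_cst (i u) e).
have [dC CE] := is_diff_comp P2 D2.
transitivity ('D_w (fun v => M (M (u, v), i u)) e).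
  apply: near_eq_derive; near=> v.
  rewrite /M /mul_in /= chart_mapK; first by rewrite /i /inv_in chart_mapK.
  near: v; apply: (near_coord1 (fun h => chart_inv q u * h)%g).
  - exact: mulgl_cts.
  - exact: open_chart_dom.
  - by rewrite mulg1.
rewrite (deriveE w dC) CE.
transitivity ('d M (u, i u) ('d M (u, e) (0, w), 0)); first by [].
have E1 : 'd M (u, e) (0, w) = 'D_(0, w) M (u, e) := esym (deriveE _ dM1).
transitivity ('d M (u, i u) ('D_(0, w) M (u, e), 0)).
  by congr ('d M _ (_, _)); exact: E1.
exact: (diff_fst_sum ('D_(0, w) M (u, e)) dM2).
Unshelve. all: by end_near. Qed.

Lemma diff_Ad w : differentiable (fun u => Ad (chart_inv q u) w) e.
Proof.
have ie : i e = e by rewrite /i /inv_in chart_inv_coord1 invg1.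
have dp : differentiable (fun u : 'rV[R]_n => (u, e)) e by exact: differentiable_pair.
have di : differentiable i e.
  apply: diff_inv_in; try exact: atlas1; first exact: coord1_cod.
  by rewrite chart_inv_coord1 invg1; exact: chart1_dom1.
have dq : differentiable (fun u : 'rV[R]_n => (u, i u)) e by exact: differentiable_pair.
have dM v : differentiable (fun u => 'D_v M u) (e, e).
  apply: diff_derive_mul_in; try exact: atlas1; try exact: coord1_cod.
  by rewrite /= chart_inv_coord1 mulg1; exact: chart1_dom1.
have dMi v : differentiable (fun u => 'D_v M u) (e, i e) by rewrite ie.
apply: (@differentiable_near _ _ _
  (\sum_(j < n) fun u => 'D_(0, w) M (u, e) 0 j *: 'D_(delta_mx 0 j, 0) M (u, i u))).
  have := Ad_chartE w; apply: filterS => u ->; by rewrite fct_sumE.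
apply: differentiable_sum => j; apply: diff_scale.
  apply: (@differentiable_comp _ _ _ _ (fun u => 'D_(0, w) M (u, e)) (fun N : 'rV[R]_n => N 0 j)).
    exact: (@differentiable_comp _ _ _ _ (fun u => (u, e)) (fun u => 'D_(0, w) M u)).
  exact: differentiable_coord.
exact: (@differentiable_comp _ _ _ _ (fun u => (u, i u)) (fun u => 'D_(delta_mx 0 j, 0) M u)).
Qed.

End Adjoint.

(** * The Lie bracket *)

Section Bracket.
Context {R : realType} {n : nat} {G : lieGroupType R n}.
Implicit Types (g h : G).
Local Notation e := (coord1 G).
Local Notation q := (chart1 G).
Local Notation br := (lie_bracket G).

Lemma is_diff_Ad w : is_diff e (fun u => Ad (chart_inv q u) w) (br^~ w).
Proof.
apply: DiffDef; first exact: diff_Ad.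
by apply/funext => x; rewrite -(deriveE x (diff_Ad w)).
Qed.

Lemma is_diff_conj g : is_diff e (conj_in g) (Ad g).
Proof.
apply: DiffDef; first exact: diff_conj_in.
by apply/funext => x; rewrite -(deriveE x (diff_conj_in g)).
Qed.

Lemma br_bilinear : bilinear_for
  (GRing.Scale.Law.clone _ _ *:%R _) (GRing.Scale.Law.clone _ _ *:%R _) br.
Proof.
split=> [y|x] k u v /=.
  have E x : br x y = 'd (fun u => Ad (chart_inv q u) y) e x.
    exact: (deriveE x (diff_Ad y)).
  by rewrite !E linearP.
have dA w : derivable (fun z => Ad (chart_inv q z) w) e x.
  exact: diff_derivable (diff_Ad w).
have AE : (fun z => Ad (chart_inv q z) (k *: u + v)) =
    k *: (fun z => Ad (chart_inv q z) u) + (fun z => Ad (chart_inv q z) v).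
  by apply/funext => z; exact: (Ad_is_linear (chart_inv q z) k u v).
rewrite /lie_bracket AE; apply: etrans (deriveD (derivableZ (dA u)) (dA v)) _.
by congr (_ + _); exact: (deriveZ _ (dA u)).
Qed.

HB.instance Definition _ := bilinear_isBilinear.Build R
  'rV[R]_n 'rV[R]_n 'rV[R]_n _ _ br br_bilinear.

(** Differentiate [Ad (g * u * g^-1) (Ad g y) = Ad g (Ad u y)] with respect to
    [u] at the identity. *)
Lemma Ad_br g x y : Ad g (br x y) = br (Ad g x) (Ad g y).
Proof.
have d0 : is_diff (conj_in g e) (fun u => Ad (chart_inv q u) (Ad g y)) (br^~ (Ad g y)).
  by rewrite conj_in1; exact: is_diff_Ad.
have d1 := is_diff_comp (is_diff_conj g) d0.
have d2 := is_diff_comp (is_diff_Ad y) (is_diff_linear_rV (@Ad R n G g) (Ad (chart_inv q e) y)).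
apply: (near_is_diff_unique _ d2 d1); near=> u.
rewrite /= chart_mapK; last by near: u; exact: near_conj_dom.
by rewrite -!AdM -mulgA mulVg mulg1.
Unshelve. all: by end_near. Qed.

(** Differentiate [Ad u (br x y) = br (Ad u x) (Ad u y)] with respect to [u] at
    the identity, in the direction [z]. *)
Lemma br_leibniz z x y : br z (br x y) = br (br z x) y + br x (br z y).
Proof.
have A1 w : Ad (chart_inv q e) w = w by rewrite chart_inv_coord1; exact: Ad1.
have d0 : is_diff (Ad (chart_inv q e) x, Ad (chart_inv q e) y)
    (fun q => br q.1 q.2) (fun q => br x q.2 + br q.1 y).
  by rewrite (A1 x) (A1 y); exact: (is_diff_bilinear_rV br (x, y)).
have d2 := is_diff_comp (is_diff_pair (is_diff_Ad x) (is_diff_Ad y)) d0.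
have E : \forall u \near e, Ad (chart_inv q u) (br x y) =
    ((fun q => br q.1 q.2) \o (fun u => (Ad (chart_inv q u) x, Ad (chart_inv q u) y))) u.
  by near=> u; exact: Ad_br.
rewrite (near_is_diff_unique E (is_diff_Ad (br x y)) d2 z).
exact: addrC.
Unshelve. all: by end_near. Qed.

Definition is_one_parameter (gamma : R -> G) (a : 'rV[R]_n) :=
  [/\ continuous gamma, forall s t, gamma (s + t) = (gamma s * gamma t)%g
    & is_derive (0 : R) (1 : R) (fun t => chart_map q (gamma t)) a].

Section OneParameter.
Context {gamma : R -> G} {a : 'rV[R]_n}.
Hypothesis gamma_a : is_one_parameter gamma a.

Lemma one_parameter0 : gamma 0 = 1%g.
Proof.
have [_ gammaD _] := gamma_a.
by apply: (@mulgI _ (gamma 0)); rewrite -gammaD addr0 mulg1.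
Qed.

Lemma is_diff_Ad_one_parameter0 y :
  is_diff (0 : R) (fun t => Ad (gamma t) y) (fun k => k *: br a y).
Proof.
have [gammac _ [d0 E0]] := gamma_a.
have d1 : is_diff (0 : R) (fun t => chart_map q (gamma t)) (fun k => k *: a).
  apply: DiffDef; first exact/derivable1_diffP.
  by rewrite deriv1E // derive1E E0.
have d2 : is_diff (chart_map q (gamma 0)) (fun u => Ad (chart_inv q u) y) (br^~ y).
  by rewrite one_parameter0; exact: is_diff_Ad.
have -> : (fun k : R => k *: br a y) = br^~ y \o (fun k => k *: a).
  by apply/funext => k /=; rewrite linearZl_LR.
apply: is_diff_near (is_diff_comp d1 d2); near=> t.
rewrite /= chart_mapK //; near: t.
apply: gammac; apply: open_nbhs_nbhs; split; first exact: open_chart_dom.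
by rewrite one_parameter0; exact: chart1_dom1.
Unshelve. all: by end_near. Qed.

Lemma is_diff_Ad_one_parameter t y :
  is_diff t (fun t => Ad (gamma t) y) (fun k => k *: Ad (gamma t) (br a y)).
Proof.
have [_ gammaD _] := gamma_a.
have d1 : is_diff t (fun s => s - t) id.
  have := is_diffB (is_diff_id t) (is_diff_cst t t).
  by rewrite subr0.
have d2 : is_diff (t - t) (fun t => Ad (gamma t) y) (fun k => k *: br a y).
  by rewrite subrr; exact: is_diff_Ad_one_parameter0.
have d3 := is_diff_comp d1 d2.
have d4 := is_diff_comp d3 (is_diff_linear_rV (@Ad R n G (gamma t)) _).
have -> : (fun k : R => k *: Ad (gamma t) (br a y)) =
   (Ad (gamma t) \o ((fun k => k *: br a y) \o id)).
  by apply/funext => k /=; rewrite linearZ.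
apply: is_diff_near d4; near=> s.
by rewrite /= -AdM -gammaD addrC subrK.
Unshelve. all: by end_near. Qed.

Lemma Ad_one_parameter_fix y : br a y = 0 -> forall t, Ad (gamma t) y = y.
Proof.
move=> ay0 t.
transitivity (Ad (gamma 0) y); last by rewrite one_parameter0 Ad1.
have d u : is_diff u (fun t => Ad (gamma t) y) (fun=> 0).
  have := is_diff_Ad_one_parameter u y.
  have -> : (fun k : R => k *: Ad (gamma u) (br a y)) = (fun=> 0).
    by apply/funext => k; rewrite ay0 linear0 scaler0.
  by [].
exact: is_diff0_cst t 0 d.
Qed.

End OneParameter.
End Bracket.

(** * The Killing form *)

Section KillingForm.
Context {R : realType} {n : nat}.
Variable br : {bilinear 'rV[R]_n -> 'rV[R]_n -> 'rV[R]_n}.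
Hypothesis leibniz : forall x y z, br x (br y z) = br (br x y) z + br y (br x z).
Local Notation ad x := (lin1_mx (br x)).
Local Notation B := (killing br).

Lemma eq_mx_act {m} (M N : 'M[R]_(n, m)) : (forall v : 'rV_n, v *m M = v *m N) -> M = N.
Proof. by move=> MN; apply/row_matrixP => i; rewrite !rowE. Qed.

Lemma killing_bilinear : bilinear_for
  (GRing.Scale.Law.clone _ _ *%R _) (GRing.Scale.Law.clone _ _ *%R _) B.
Proof.
have adP k x y : ad (k *: x + y) = k *: ad x + ad y.
  by apply/matrixP => i j; rewrite !mxE linearPl !mxE.
split=> [y|x] k u v /=; rewrite /killing adP.
  by rewrite mulmxDl -scalemxAl mxtraceD mxtraceZ.
by rewrite mulmxDr -scalemxAr mxtraceD mxtraceZ.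
Qed.

HB.instance Definition _ := bilinear_isBilinear.Build R
  'rV[R]_n 'rV[R]_n R _ _ B killing_bilinear.

(** The order of the products is that of matrices acting on row vectors from the
    right. *)
Lemma ad_br x y : ad (br x y) = ad y *m ad x - ad x *m ad y.
Proof.
apply: eq_mx_act => v; rewrite mulmxBr !mulmxA !mul_rV_lin1 /=.
by rewrite (leibniz x y v) addrK.
Qed.

Lemma killing_br x y z : B (br x y) z = B x (br y z).
Proof.
rewrite /killing !ad_br; move: (ad x) (ad y) (ad z) => X Y Z.
rewrite mulmxBl mulmxBr !raddfB /=; congr (_ - _); last by rewrite mulmxA.
by rewrite -[Y *m X *m Z]mulmxA mxtrace_mulC mulmxA.
Qed.

(** By the Leibniz identity, [br x x] acts as the commutator of [br x] with
    itself. *)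
Lemma br_alternating x : (forall w, (forall z, B w z = 0) -> w = 0) -> br x x = 0.
Proof.
move=> nondeg; apply: nondeg => z.
by rewrite /killing ad_br subrr mul0mx mxtrace0.
Qed.

(** An automorphism conjugates [br x] into [br (A x)], and the trace is invariant
    under conjugation. *)
Lemma killing_aut (A A' : {linear 'rV[R]_n -> 'rV[R]_n}) :
  cancel A A' -> cancel A' A -> (forall x y, A (br x y) = br (A x) (A y)) ->
  forall x y, B (A x) (A y) = B x y.
Proof.
move=> AK A'K Abr x y.
have adA z : ad (A z) = lin1_mx A' *m ad z *m lin1_mx A.
  apply: eq_mx_act => v; rewrite !mulmxA !mul_rV_lin1 /=.
  by rewrite Abr A'K.
have AA : lin1_mx A *m lin1_mx A' = 1%:M.
  by apply: eq_mx_act => v; rewrite mulmxA !mul_rV_lin1 /= AK mulmx1.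
rewrite /killing !adA; move: (ad x) (ad y) => X Y.
rewrite -!mulmxA (mulmxA (lin1_mx A) (lin1_mx A')) AA mul1mx mxtrace_mulC.
by rewrite -!mulmxA AA mulmx1.
Qed.

Section Cartan.
Variable theta : {linear 'rV[R]_n -> 'rV[R]_n}.
Hypothesis cartan : is_cartan_involution br theta.
Local Notation p := (cartan_p theta).

Lemma br_xx x : br x x = 0.
Proof.
apply: br_alternating => w w0; have [_ _ pos] := cartan.
by apply: contrapT => /eqP/pos; rewrite w0 oppr0 ltxx.
Qed.

Lemma brC x y : br x y = - br y x.
Proof.
apply/eqP; rewrite -addr_eq0.
have := br_xx (x + y).
by rewrite linearDr /= !linearDl /= !br_xx add0r addr0 addrC => ->.
Qed.

Lemma killing_p_gt0 x : p x -> x != 0 -> 0 < B x x.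
Proof.
have [_ _ pos] := cartan; rewrite /cartan_p /= => px /pos.
by rewrite px linearNr opprK.
Qed.

Lemma killing_k_eq0 x : cartan_k theta x -> B x x = 0 -> x = 0.
Proof.
have [_ _ pos] := cartan; rewrite /cartan_k /= => kx Bx; apply: contrapT => /eqP/pos.
by rewrite kx Bx oppr0 ltxx.
Qed.

Lemma br_pp x y : p x -> p y -> cartan_k theta (br x y).
Proof.
have [aut _ _] := cartan; rewrite /cartan_p /cartan_k /= => px py.
by rewrite aut px py linearNl linearNr opprK.
Qed.

End Cartan.
End KillingForm.

Section KillingAd.
Context {R : realType} {n : nat} {G : lieGroupType R n}.
Local Notation br := (lie_bracket G).
Local Notation B := (killing br).

Lemma killing_Ad (g : G) x y : B (Ad g x) (Ad g y) = B x y.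
Proof.
have AK : cancel (@Ad R n G g) (@Ad R n G g^-1%g).
  by move=> z; rewrite -AdM mulVg Ad1.
have AVK : cancel (@Ad R n G g^-1%g) (@Ad R n G g).
  by move=> z; rewrite -AdM mulgV Ad1.
exact: (killing_aut br _ _ AK AVK (Ad_br g)).
Qed.

Lemma killing_stationary (gamma : R -> G) a x xi : is_one_parameter gamma a ->
  (forall t, B x xi <= B (Ad (gamma t) x) xi) -> B (br a x) xi = 0.
Proof.
move=> ga xmin.
have Llin : linear (fun x => B x xi : R^o) by move=> k u v; rewrite linearPl.
pose L : {linear 'rV[R]_n -> R^o} := HB.pack (fun x => B x xi : R^o)
  (GRing.isLinear.Build _ _ _ _ (fun x => B x xi : R^o) Llin).
have d t := is_diff_comp (is_diff_Ad_one_parameter ga t x) (is_diff_linear_rV L _).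
have g0 : Ad (gamma 0) x = x by rewrite (one_parameter0 ga) Ad1.
have [d0 v0] : is_derive (0 : R) 1 (fun t => L (Ad (gamma t) x)) 0.
  apply: (derive1_at_min (a := -1) (b := 1)).
  - by lra.
  - by move=> t _; exact: diff_derivable (ex_diff (is_diff_def := d t)).
  - by rewrite in_itv /= ltrN10 ltr01.
  - by move=> t _; rewrite g0; exact: xmin.
have d1 := ex_diff (is_diff_def := d 0).
rewrite -v0 (deriveE (1 : R) d1) (diff_val (is_diff_def := d 0)) /=.
by rewrite scale1r (one_parameter0 ga) Ad1.
Qed.

End KillingAd.

(** * Subalgebras adapted to a face *)

Section Adapted.
Context {R : realType} {n : nat} {G : lieGroupType R n}.
Variable theta : {linear 'rV[R]_n -> 'rV[R]_n}.
Local Notation br := (lie_bracket G).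
Local Notation B := (killing br).
Hypothesis cartan : is_cartan_involution br theta.
Variable K : set G.
Hypothesis lieK : lie_of_subgroup K = cartan_k theta.
Local Notation p := (cartan_p theta).
Implicit Types (s : {vspace 'rV[R]_n}) (C E F : set 'rV[R]_n).

Lemma cartan_p0 : p 0.
Proof. by rewrite /cartan_p /= linear0 oppr0. Qed.

Lemma cartan_pP k x y : p x -> p y -> p (k *: x + y).
Proof.
by rewrite /cartan_p /= => px py; rewrite linearP px py scalerN opprD.
Qed.

Lemma centralizer_vspace s :
  exists W : {vspace 'rV[R]_n},
    forall x, x \in W <-> centralizer_in br p [set` s] x.
Proof.
apply: exists_vspace; first by split=> [|sg _]; [exact: cartan_p0 | exact: linear0l].
move=> k x y [px xs] [py ys]; split=> [|sg sgs]; first exact: cartan_pP.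
by rewrite linearPl /= xs // ys // scaler0 addr0.
Qed.

(** The bracket [a] of [x] and [xi] generates a one-parameter subgroup of [K^s],
    along which the product with [xi] is minimal at [x].  Its derivative is
    [B (br a x) xi = B a a]. *)
Lemma critical_commute s C x xi :
  (forall k y, fixator K [set` s] k -> C y -> C (Ad k y)) ->
  centralizer_in br p [set` s] x -> centralizer_in br p [set` s] xi ->
  C x -> (forall y, C y -> B x xi <= B y xi) -> br x xi = 0.
Proof.
move=> CK [px xs] [pxi xis] Cx xmin.
have brK : cartan_k theta (br x xi) by exact: (br_pp _ _ cartan).
have ad0 sg : sg \in s -> br (br x xi) sg = 0.
  move=> sgs; have := br_leibniz (G := G) x xi sg.
  by rewrite (xis _ sgs) (xs _ sgs) !linear0r addr0 => <-.
have : lie_of_subgroup K (br x xi) by rewrite lieK.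
move=> [gamma [gc gD g' gK]].
have ga : is_one_parameter gamma (br x xi) by [].
have gs t : fixator K [set` s] (gamma t).
  split=> [|sg sgs]; first exact: gK.
  exact: (Ad_one_parameter_fix ga _ (ad0 _ sgs)).
apply: (killing_k_eq0 _ _ cartan _ brK).
rewrite -(killing_br _ br_leibniz).
apply: (killing_stationary _ _ _ _ ga) => t.
by apply: xmin; exact: CK.
Qed.

Lemma killing_affine C c0 sg q : C c0 ->
  (forall x y, C x -> C y -> B (x - y) sg = 0 :> R) ->
  affine_hull C q -> B q sg = B c0 sg.
Proof.
move=> Cc0 C0 [m [x [a [Cx a1 ->]]]].
rewrite linear_sumlz.
have E i : B (x i) sg = B c0 sg.
  by apply/eqP; rewrite -subr_eq0 -linearBl /= C0.
under eq_bigr do rewrite linearZl_LR /= E.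
by rewrite -mulr_suml a1 mul1r.
Qed.

Lemma affine_hull_p C q : C `<=` p -> affine_hull C q -> p q.
Proof.
move=> Cp [m [x [a [Cx a1 ->]]]].
by apply: (big_rec p) => [|i y _ py]; [exact: cartan_p0 | exact/cartan_pP/py/Cp].
Qed.

Definition adapted s C :=
  [/\ is_abelian br s, [set` s] `<=` p,
      C `<=` centralizer_in br p [set` s], Ad_invariant (fixator K [set` s]) C
    & forall x y sg, C x -> C y -> sg \in s -> B (x - y) sg = 0 :> R].

Lemma adapted_argmin s C xi : adapted s C -> centralizer_in br p [set` s] xi ->
  adapted (s + <[xi]>)%VS [set x | C x /\ forall y, C y -> B x xi <= B y xi].
Proof.
move=> [sab sp Cs CK Corth] [pxi xis].
have xi_in : xi \in (s + <[xi]>)%VS by exact: (subvP (addvSr _ _) _ (memv_line xi)).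
have s_in sg : sg \in s -> sg \in (s + <[xi]>)%VS by exact: (subvP (addvSl _ _)).
split.
- move=> _ _ /memv_addP[sg sgs [_ /vlineP[k ->] ->]] /memv_addP[tau taus [_ /vlineP[l ->] ->]].
  rewrite linearDl !linearDr /= linearZl_LR !linearZr_LR linearZl_LR /=.
  rewrite (sab _ _ sgs taus) (br_xx _ br_leibniz _ cartan) (xis _ taus).
  have -> : br sg xi = - br xi sg by exact: (brC _ br_leibniz _ cartan).
  by rewrite (xis _ sgs) oppr0 !scaler0 !addr0.
- move=> _ /= /memv_addP[sg sgs [_ /vlineP[k ->] ->]].
  by rewrite addrC; apply: cartan_pP => //; exact: sp.
- move=> x [Cx xmin]; split=> [|_ /= /memv_addP[sg sgs [_ /vlineP[k ->] ->]]].
    by have [] := Cs x Cx.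
  have xxi : br x xi = 0.
    exact: (critical_commute _ _ _ _ CK (Cs x Cx) (conj pxi xis) Cx xmin).
  have [_ xs] := Cs x Cx.
  by rewrite linearDr linearZr_LR /= xxi (xs _ sgs) scaler0 addr0.
- move=> k x [Kk kfix] [Cx xmin]; split=> [|y Cy].
    by apply: CK => //; split=> // sg sgs; apply: kfix; exact: s_in.
  have -> : B (Ad k x) xi = B x xi.
    by have := killing_Ad k x xi; rewrite (kfix _ xi_in).
  exact: xmin.
- move=> x y _ [Cx xmin] [Cy ymin] /memv_addP[sg sgs [_ /vlineP[k ->] ->]].
  rewrite linearDr linearZr_LR /= (Corth _ _ _ Cx Cy sgs) add0r linearBl /=.
  have -> : B x xi = B y xi :> R.
    by apply: le_anti; apply/andP; split; [exact: xmin | exact: ymin].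
  by rewrite subrr mulr0.
Qed.

(** One step of the construction.  The dimension increases because [B _ xi] is
    not constant on [C], whereas [B _ sg] is constant on [C] for [sg] in [s]. *)
Lemma adapted_shrink s C F : adapted s C -> convex_set C -> convex_set F ->
  F !=set0 -> F `<=` C -> extreme_in C F -> ~ (C `<=` F) ->
  exists s' C', [/\ (\dim s < \dim s')%N, adapted s' C', F `<=` C', C' `<=` C
    & convex_set C'].
Proof.
move=> sC Cconv Fconv F0 FC Fext NCF.
have [W WE] := centralizer_vspace s; have [_ _ Cs _ Corth] := sC.
have posW : posdef_on (killing br) W.
  by move=> x /WE[px _]; exact: (killing_p_gt0 _ _ cartan).
have CW x (Cx : C x) : x \in W := (WE x).2 (Cs x Cx).
have [xi /WE xis [ximin [c [f [Cc Ff fc]]]]] :=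
  face_support (killing br) W C F posW CW Cconv Fconv F0 FC Fext NCF.
have xiNs : xi \notin s.
  apply/negP => xi_s; move: fc.
  by rewrite -subr_gt0 -linearBl /= (Corth _ _ _ Cc (FC _ Ff) xi_s) ltxx.
exists (s + <[xi]>)%VS, [set x | C x /\ forall y, C y -> B x xi <= B y xi].
split; last 1 first.
- apply/convex_setP => x y t t01 [Cx xmin] [Cy ymin].
  split=> [|z Cz]; first exact: (convex_setP.1 Cconv).
  rewrite linearDl !linearZl_LR /=.
  have -> : B y xi = B x xi :> R.
    by apply: le_anti; apply/andP; split; [exact: ymin | exact: xmin].
  by rewrite -mulrDl subrK mul1r; exact: xmin.
- rewrite ltn_neqAle dimvS ?addvSl // andbT; apply: contraNneq xiNs => dimE.
  have /eqP -> : (s == s + <[xi]>)%VS by rewrite eqEdim addvSl dimE leqnn.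
  exact: (subvP (addvSr _ _) _ (memv_line xi)).
- exact: adapted_argmin sC xis.
- by move=> x Fx; split=> [|y Cy]; [exact: FC | exact: ximin].
- by move=> x [].
Qed.

(** Repeated shrinking from [0] and [E] ends at [F], as the dimension of [s] is
    bounded. *)
Lemma exists_adapted_face E F : E `<=` p -> convex_set E -> Ad_invariant K E ->
  is_face E F -> exists s, adapted s F.
Proof.
move=> Ep Econv EK Fface; have [F0 Fconv FE _] := Fface.
have Fext := face_extreme Fface.
suff main m s C : (\dim {:'rV[R]_n} < m + \dim s)%N -> adapted s C ->
    F `<=` C -> C `<=` E -> convex_set C -> exists s, adapted s F.
  apply: (main (\dim {:'rV[R]_n}).+1 0%VS E) => //; first by rewrite ltn_addr.
  split.
  - by move=> x y; rewrite !memv0 => /eqP-> _; exact: linear0l.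
  - by move=> x /=; rewrite memv0 => /eqP->; exact: cartan_p0.
  - move=> x Ex; split; first exact: Ep.
    by move=> sg /=; rewrite memv0 => /eqP->; exact: linear0r.
  - by move=> k x [Kk _] Ex; exact: EK.
  - by move=> x y sg _ _; rewrite memv0 => /eqP->; exact: linear0r.
(* [m] bounds the number of vectors that can still be added to [s]. *)
elim: m s C => [|m IH] s C dimS sC FC CE Cconv.
  by have := leq_trans dimS (dimvS (subvf s)); rewrite ltnn.
have [CF|NCF] := pselect (C `<=` F).
  by exists s; have <- : C = F by apply/seteqP.
have CFext : extreme_in C F by move=> x y t /CE Ex /CE; exact: Fext.
have [s' [C' [ss' sC' FC' CC' C'conv]]] :=
  adapted_shrink s C F sC Cconv Fconv F0 FC CFext NCF.
apply: (IH s' C') => //; last exact: subset_trans CE.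
by rewrite (leq_trans dimS) // addSnnS leq_add2l.
Qed.

End Adapted.

Theorem proposition1p2 (R : realType) (n : nat) (G : lieGroupType R n)
    (theta : {linear 'rV[R]_n -> 'rV[R]_n}) (K : set G)
    (E F : set 'rV[R]_n) :
  connected [set: G] ->
  is_semisimple (lie_bracket G) ->
  is_cartan_involution (lie_bracket G) theta ->
  is_maximal_compact_subgroup K ->
  lie_of_subgroup K = cartan_k theta ->
  E `<=` cartan_p theta ->
  is_convex_body E ->
  Ad_invariant K E ->
  is_face E F ->
  exists s : {vspace 'rV[R]_n},
    [/\ is_subalgebra (lie_bracket G) s,
        is_abelian (lie_bracket G) s,
        [set` s] `<=` cartan_p theta,
        F `<=` centralizer_in (lie_bracket G) (cartan_p theta) [set` s] /\
        Ad_invariant (fixator K [set` s]) F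
      & direction F `<=`
        orthogonal_in (lie_bracket G) (cartan_p theta) [set` s]].
Proof.
move=> _ _ cartan _ lieK Ep [_ _ Econv] EK Fface.
have [s [sab sp Fs FK Forth]] := exists_adapted_face theta cartan K lieK E F Ep Econv EK Fface.
exists s; split=> //.
  by move=> x y xs ys; rewrite sab // mem0v.
have [[f0 Ff0] _ FE _] := Fface.
have Fp : F `<=` cartan_p theta := subset_trans FE Ep.
move=> _ [q1 q1F [q2 q2F <-]]; split=> [|sg sgs].
  rewrite addrC -scaleN1r; apply: cartan_pP.
    exact: affine_hull_p Fp q1F.
  exact: affine_hull_p Fp q2F.
have F0 x y : F x -> F y -> killing (lie_bracket G) (x - y) sg = 0.
  by move=> Fx Fy; exact: Forth.
rewrite linearBl /= (killing_affine _ _ _ _ Ff0 F0 q1F).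
by rewrite (killing_affine _ _ _ _ Ff0 F0 q2F) subrr.
Qed.
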